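(* Let $G=(V,E,w)$ be a finite connected graph with $|V|=n\ge2$ and weights $w:E\to\mathbb{R}_{>0}$. For every connected binary hierarchy $T\in\mathcal T_{\mathrm{conn}}^{\mathrm{bin}}(G)$, $$\frac{\operatorname{cost}_D^-(T)}{F(T)}=\sum_{S\in\mathcal I(T)}\mu_T(S)\rho_T(S)=\mathbb E_{\mu_T}[\rho_T].$$ In particular, if $T_\star\in\mathcal T_{\mathrm{conn}}^{\mathrm{bin}}(G)$ is free optimal, i.e. $F(T_\star)=\operatorname{OPT}_{\mathrm{free}}(G,w)$, then $$\frac{\operatorname{OPT}_{\mathrm{card}}(G,w)}{\operatorname{OPT}_{\mathrm{free}}(G,w)}\le\mathbb E_{\mu_{T_\star}}[\rho_{T_\star}].$$
   Context: $d_G$ is the shortest-path metric of $(V,E)$ with every edge of length $1$ (weights are not lengths); $\operatorname{diam}_{d_G}(S)=\max_{a,b\in S}d_G(a,b)$. A rooted binary hierarchy $T$ on $V$ is a rooted tree whose leaves are the vertices of $V$ and whose internal nodes have exactly two children; each node is identified with the set of leaves below it (a cluster); $C_T(x,y)$ is the cluster of the lowest common ancestor of $x,y$. $\mathcal T_{\mathrm{conn}}^{\mathrm{bin}}(G)$ is the set of rooted binary hierarchies all of whose clusters induce connected subgraphs of $G$. $\mathcal I(T)$ is the family of internal (non-leaf) clusters. For $S\in\mathcal I(T)$ with children $S^0,S^1$: $b_T(S)$ is the total weight of edges with one endpoint in $S^0$ and the other in $S^1$; $\Delta_T(S)=\operatorname{diam}_{d_G}(S)$; $a_T(S)=\Delta_T(S)b_T(S)$;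 $\rho_T(S)=(|S|-1)/\Delta_T(S)$. $F(T)=\sum_{xy\in E}w_{xy}\operatorname{diam}_{d_G}(C_T(x,y))>0$, and $\mu_T(S)=a_T(S)/F(T)$, which is a probability measure on $\mathcal I(T)$. $\operatorname{cost}_D^-(T)=\sum_{xy\in E}w_{xy}(|C_T(x,y)|-1)$. $\operatorname{OPT}_{\mathrm{free}}(G,w)$ is the minimum of $\sum_{xy\in E}w_{xy}u(x,y)$ over all ultrametrics $u$ on $V$ (metrics with $u(x,y)\le\max\{u(x,z),u(z,y)\}$) with $u\ge d_G$ on all pairs. Put $h_H(x,x)=0$, $h_H(x,y)=|C_H(x,y)|-1$ for $x\ne y$; $\operatorname{OPT}_{\mathrm{card}}(G,w)$ is the minimum of $\sum_{xy\in E}w_{xy}h_H(x,y)$ over all rooted binary hierarchies $H$ on $V$ with $h_H\ge d_G$ on all pairs. *)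

(* Defs.v *)
From HB Require Import structures.
From mathcomp Require Import classical_sets reals.
From mathcomp Require Import all_boot all_order all_algebra.

Set Implicit Arguments.
Unset Strict Implicit.
Unset Printing Implicit Defensive.

Import Order.TTheory GRing.Theory Num.Theory.
Local Open Scope ring_scope.

(* Weights are given as a symmetric function on ordered pairs; only its values
   on adjacent pairs are ever used. *)
Record wgraph (R : realType) (V : finType) := WGraph {
  adj : rel V;
  wt : V -> V -> R;
  adj_sym : symmetric adj;
  adj_irr : irreflexive adj;
  adj_conn : forall x y, connect adj x y;
  wt_sym : forall x y, wt x y = wt y x;
  wt_gt0 : forall x y, adj x y -> 0 < wt x y
}.

Section Metric.
Variables (R : realType) (V : finType) (G : wgraph R V).

Definition walk (x y : V) (k : nat) : bool :=
  [exists p : k.-tuple V, path (adj G) x p && (last x p == y)].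

Lemma walk_ex x y : exists k, walk x y k.
Proof.
have /connectP[p Hp ->] := adj_conn G x y.
by exists (size p); apply/existsP; exists (in_tuple p); rewrite Hp eqxx.
Qed.

Definition dist (x y : V) : nat := ex_minn (walk_ex x y).

Definition diam (S : {set V}) : nat :=
  (\max_(a in S) \max_(b in S) dist a b)%N.

(* For symmetric f this is the sum of w_xy f(x,y) over the undirected edges:
   the double sum meets every edge twice. *)
Definition edge_sum (f : V -> V -> R) : R :=
  2^-1 * \sum_(x : V) \sum_(y : V | adj G x y) wt G x y * f x y.

Definition induces_connected (S : {set V}) : Prop :=
  forall x y, x \in S -> y \in S ->
    connect [rel a b | [&& a \in S, b \in S & adj G a b]] x y.

End Metric.

Section Hierarchies.
Variable V : finType.

(* The two children of a node are ordered here; every quantity defined below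
   is invariant under swapping them. *)
Inductive btree : Type := Leaf of V | Node of btree & btree.

Fixpoint leaves (t : btree) : seq V :=
  match t with
  | Leaf v => [:: v]
  | Node l r => leaves l ++ leaves r
  end.

Record hierarchy := Hierarchy {
  tree :> btree;
  tree_leaves : perm_eq (leaves tree) (enum V)
}.

Definition cluster (t : btree) : {set V} := [set x in leaves t].

Fixpoint clusters (t : btree) : {set {set V}} :=
  match t with
  | Leaf v => [set cluster (Leaf v)]
  | Node l r => cluster (Node l r) |: (clusters l :|: clusters r)
  end.

Fixpoint internal (t : btree) : {set {set V}} :=
  match t with
  | Leaf _ => set0
  | Node l r => cluster (Node l r) |: (internal l :|: internal r)
  end.

(* The child clusters (S^0, S^1) of an internal cluster S; junk otherwise. *)
Fixpoint children (t : btree) (S : {set V}) : {set V} * {set V} :=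
  match t with
  | Leaf _ => (set0, set0)
  | Node l r =>
      if S == cluster (Node l r) then (cluster l, cluster r)
      else if S \subset cluster l then children l S else children r S
  end.

Fixpoint lca (t : btree) (x y : V) : {set V} :=
  match t with
  | Leaf v => cluster (Leaf v)
  | Node l r =>
      if (x \in leaves l) && (y \in leaves l) then lca l x y
      else if (x \in leaves r) && (y \in leaves r) then lca r x y
      else cluster (Node l r)
  end.

Definition hcard (H : hierarchy) (x y : V) : nat :=
  if x == y then 0%N else (#|lca H x y| - 1)%N.

End Hierarchies.

Section Costs.
Variables (R : realType) (V : finType) (G : wgraph R V).

Definition connected_hierarchy (T : hierarchy V) : Prop :=
  forall S, S \in clusters T -> induces_connected G S.

Definition Fdiam (T : hierarchy V) : R :=
  edge_sum G (fun x y => (diam G (lca T x y))%:R).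

Definition cost_D (T : hierarchy V) : R :=
  edge_sum G (fun x y => (#|lca T x y| - 1)%:R).

Definition b_ (T : hierarchy V) (S : {set V}) : R :=
  \sum_(x in (children T S).1) \sum_(y in (children T S).2 | adj G x y)
     wt G x y.

Definition a_ (T : hierarchy V) (S : {set V}) : R := (diam G S)%:R * b_ T S.

Definition rho (S : {set V}) : R := (#|S| - 1)%:R / (diam G S)%:R.

Definition mu (T : hierarchy V) (S : {set V}) : R := a_ T S / Fdiam T.

Definition ultrametric (u : V -> V -> R) : Prop :=
  [/\ forall x y, 0 <= u x y,
      forall x y, u x y = 0 <-> x = y,
      forall x y, u x y = u y x,
      forall x y z, u x y <= u x z + u z y
    & forall x y z, u x y <= Num.max (u x z) (u z y)].

(* Both minima below are attained, so that inf is the minimum. *)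
Definition OPT_free : R :=
  inf [set c | exists u : V -> V -> R,
    [/\ ultrametric u, forall x y, (dist G x y)%:R <= u x y
      & c = edge_sum G u]]%classic.

Definition OPT_card : R :=
  inf [set c | exists H : hierarchy V,
    (forall x y, (dist G x y <= hcard H x y)%N) /\
    c = edge_sum G (fun x y => (hcard H x y)%:R)]%classic.

End Costs.

(* Expectation of f for the probability mass function p carried by A. *)
Definition expectation (R : realType) (I : finType) (A : {set I})
    (p f : I -> R) : R :=
  \sum_(i in A) p i * f i.

(* Main.v *)
(* Grouping the edges by the cluster of the lowest common ancestor of their
   endpoints turns an edge sum of f(C_T(x,y)) into the sum over the internal
   clusters S of b_T(S) f(S); taking f(S) = |S| - 1 = diam(S) rho(S) gives the
   identity.  For the bound, a connected cluster S containing x and y contains a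
   simple path joining them, so d_G(x,y) <= |S| - 1: hence T itself competes
   in OPT_card. *)
Require Import Defs.
From mathcomp Require Import all_boot all_order all_algebra.
From mathcomp Require Import reals.

Set Implicit Arguments.
Unset Strict Implicit.
Unset Printing Implicit Defensive.

Import Order.TTheory GRing.Theory Num.Theory.
Local Open Scope ring_scope.

Lemma sum_setU_disjoint (M : nmodType) (I : finType) (A B : {set I})
    (F : I -> M) : [disjoint A & B] ->
  \sum_(i in A :|: B) F i = \sum_(i in A) F i + \sum_(i in B) F i.
Proof. by move=> dAB; rewrite -bigU //; apply: eq_bigl => i; rewrite !inE. Qed.

(** * Clusters, children and lowest common ancestors in a binary tree *)

Section Trees.
Variable V : finType.
Implicit Types (t l r : btree V) (S : {set V}) (T : hierarchy V).

Lemma cluster_node l r : cluster (Node l r) = cluster l :|: cluster r.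
Proof. by apply/setP => x; rewrite !inE mem_cat. Qed.

Lemma cluster_neq0 t : cluster t != set0.
Proof.
elim: t => [v|l IHl r _]; last by rewrite cluster_node setU_eq0 negb_and IHl.
by apply/set0Pn; exists v; rewrite !inE.
Qed.

Lemma cluster_hierarchy T : cluster T = [set: V].
Proof.
by apply/setP => x; rewrite !inE (perm_mem (tree_leaves T)) mem_enum.
Qed.

Lemma uniq_leaves T : uniq (leaves T).
Proof. by rewrite (perm_uniq (tree_leaves T)) enum_uniq. Qed.

Lemma uniq_leaves_node l r : uniq (leaves (Node l r)) ->
  [/\ uniq (leaves l), uniq (leaves r) & [disjoint cluster l & cluster r]].
Proof.
rewrite /= cat_uniq => /and3P[ul /hasPn lr ur]; split=> //.
rewrite disjoint_sym disjoint_subset; apply/subsetP => x.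
by rewrite !inE => /lr.
Qed.

Lemma internal_sub t S : S \in internal t -> S \subset cluster t.
Proof.
elim: t => [v|l IHl r IHr]; first by rewrite inE.
rewrite cluster_node !inE cluster_node => /or3P[/eqP->//|/IHl|/IHr] sub.
  by rewrite subsetU ?sub.
by rewrite subsetU ?sub ?orbT.
Qed.

Lemma internal_cluster t S : S \in internal t ->
  exists s, S = cluster s.
Proof.
elim: t => [v|l IHl r IHr]; first by rewrite inE.
by rewrite !inE => /or3P[/eqP->|/IHl|/IHr] //; exists (Node l r).
Qed.

Lemma internal_neq0 t S : S \in internal t -> S != set0.
Proof. by case/internal_cluster => s ->; apply: cluster_neq0. Qed.

(** The two children are disjoint and nonempty. This keeps [diam G S], the denominator of [rho],
    away from 0. *)
Lemma card_internal_gt1 t S : uniq (leaves t) -> S \in internal t ->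
  (1 < #|S|)%N.
Proof.
elim: t => [v|l IHl r IHr]; first by rewrite inE.
case/uniq_leaves_node => ul ur dlr.
rewrite !inE => /or3P[/eqP->|/(IHl ul)|/(IHr ur)] //.
rewrite cluster_node cardsU disjoint_setI0 // cards0 subn0.
by rewrite -addn1 leq_add // card_gt0 cluster_neq0.
Qed.

Lemma lca_clusters t x y : x \in leaves t -> y \in leaves t ->
  [/\ lca t x y \in clusters t, x \in lca t x y & y \in lca t x y].
Proof.
elim: t => [v|l IHl r IHr] /=; first by rewrite !inE => -> ->.
case: ifP => [/andP[xl yl] _ _|_].
  by have [lT -> ->] := IHl xl yl; rewrite !inE lT orbT.
case: ifP => [/andP[xr yr] _ _|_ xt yt].
  by have [rT -> ->] := IHr xr yr; rewrite !inE rT !orbT.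
by rewrite !inE /= eqxx xt yt.
Qed.

(** As [internal] is a set of clusters, the sum splits only if no cluster arises twice. A
    coincidence would give a point common to the disjoint clusters of [l] and [r]. *)
Lemma big_internal_node (M : nmodType) (F : {set V} -> M) l r :
  uniq (leaves (Node l r)) ->
  \sum_(S in internal (Node l r)) F S =
    F (cluster (Node l r)) + (\sum_(S in internal l) F S
                              + \sum_(S in internal r) F S).
Proof.
case/uniq_leaves_node => ul ur dlr /=.
have cl S : S \in internal l -> S \notin internal r.
  move=> Sl; apply/negP => Sr; have /set0Pn[x xS] := internal_neq0 Sl.
  have /subsetP/(_ x xS) xr := internal_sub Sr.
  have /subsetP/(_ x xS) xl := internal_sub Sl.
  by rewrite (disjointFr dlr xl) in xr.
rewrite big_setU1 /=.
  rewrite sum_setU_disjoint // disjoint_subset; apply/subsetP => S /cl.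
  by rewrite inE.
rewrite !inE negb_or cluster_node.
(* If the cluster of the node were internal to one child, that child would contain its nonempty
   sibling. *)
apply/andP; split; apply/negP => /internal_sub; rewrite subUset => /andP[sl sr].
- have /set0Pn[x xr] := cluster_neq0 r.
  by have := subsetP sr x xr; rewrite (disjointFl dlr xr).
- have /set0Pn[x xl] := cluster_neq0 l.
  by have := subsetP sl x xl; rewrite (disjointFr dlr xl).
Qed.

(** The inclusion test in [children] picks the correct side: a nonempty cluster below [r] is not
    contained in [cluster l], and no cluster below one child is the whole node. *)
Lemma children_node l r : uniq (leaves (Node l r)) ->
  [/\ children (Node l r) (cluster (Node l r)) = (cluster l, cluster r),
      {in internal l, children (Node l r) =1 children l}
    & {in internal r, children (Node l r) =1 children r}].
Proof.
case/uniq_leaves_node => ul ur dlr; split=> /=; first by rewrite eqxx.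
  move=> S Sl; have Sub := internal_sub Sl; rewrite Sub ifN //.
  apply/eqP => SE; have /set0Pn[x xr] := cluster_neq0 r.
  have := subsetP Sub x; rewrite SE cluster_node inE xr orbT => /(_ isT).
  by rewrite (disjointFl dlr xr).
move=> S Sr; have Sub := internal_sub Sr; rewrite !ifN //.
  apply/negP => Sl; have /set0Pn[x xS] := internal_neq0 Sr.
  have := subsetP Sl x xS; have := subsetP Sub x xS => xr.
  by rewrite (disjointFl dlr xr).
apply/eqP => SE; have /set0Pn[x xl] := cluster_neq0 l.
have := subsetP Sub x; rewrite SE cluster_node inE xl => /(_ isT).
by rewrite (disjointFr dlr xl).
Qed.

Lemma lca_node l r x y : uniq (leaves (Node l r)) ->
  [/\ x \in cluster l -> y \in cluster l -> lca (Node l r) x y = lca l x y,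
      x \in cluster r -> y \in cluster r -> lca (Node l r) x y = lca r x y,
      x \in cluster l -> y \in cluster r ->
        lca (Node l r) x y = cluster (Node l r)
    & x \in cluster r -> y \in cluster l ->
        lca (Node l r) x y = cluster (Node l r)].
Proof.
case/uniq_leaves_node => _ _ dlr.
have nr z : z \in cluster l -> (z \in leaves r) = false.
  by move=> zl; have := disjointFr dlr zl; rewrite inE.
have nl z : z \in cluster r -> (z \in leaves l) = false.
  by move=> zr; have := disjointFl dlr zr; rewrite inE.
split=> xin yin /=.
- by move: xin yin; rewrite !inE => -> ->.
- by rewrite nl //; move: xin yin; rewrite !inE => -> ->.
- by rewrite (nl y) // (nr x) // andbF.
- by rewrite (nl x) // (nr y) // andbF.
Qed.

End Trees.

(** * Distances, diameters and connected clusters *)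

Section Graph.
Variables (R : realType) (V : finType) (G : wgraph R V).
Implicit Types (t l r : btree V) (S A B : {set V}) (T : hierarchy V).

Lemma dist_le_walk x y k : walk G x y k -> (dist G x y <= k)%N.
Proof. by rewrite /dist; case: ex_minnP => m _; apply. Qed.

Lemma walk_dist x y : walk G x y (dist G x y).
Proof. by rewrite /dist; case: ex_minnP. Qed.

Lemma dist_gt0 x y : x != y -> (0 < dist G x y)%N.
Proof.
have := walk_dist x y; case: (dist G x y) => // /existsP[p].
by rewrite tuple0 /= => ->.
Qed.

Lemma distxx x : dist G x x = 0%N.
Proof.
apply/eqP; rewrite -leqn0; apply: dist_le_walk.
by apply/existsP; exists [tuple]; rewrite /= eqxx.
Qed.

Lemma dist_le_diam S x y : x \in S -> y \in S -> (dist G x y <= diam G S)%N.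
Proof.
move=> xS yS; apply: leq_trans (leq_bigmax_cond _ xS).
exact: (leq_bigmax_cond _ yS).
Qed.

Lemma diam_gt0 S : (1 < #|S|)%N -> (0 < diam G S)%N.
Proof.
case/card_gt1P => x [y [xS yS xy]].
exact: leq_trans (dist_gt0 xy) (dist_le_diam xS yS).
Qed.

Lemma dist_lt_card S x y : induces_connected G S -> x \in S -> y \in S ->
  (dist G x y < #|S|)%N.
Proof.
move=> conS xS yS; have /connectP[p0 p0S ->] := conS x y xS yS.
(* The path is shortened inside the graph induced on [S], so it becomes simple without leaving
   [S]. *)
case/shortenP: p0S => p pS up _.
have pinS : {subset x :: p <= S}.
  elim: p x xS pS {up} => [|z p IHp] x xS /=.
    by move=> _ z; rewrite inE => /eqP->.
  case/andP=> /and3P[_ zS _] pS u; rewrite inE => /predU1P[->//|].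
  exact: IHp pS u.
have sz : (size (x :: p) <= #|S|)%N.
  by rewrite -(card_uniqP up) subset_leq_card //; apply/subsetP.
(* [x :: p] has one vertex more than the walk has edges, hence the strict bound. *)
apply: leq_trans sz; rewrite ltnS; apply: dist_le_walk.
apply/existsP; exists (in_tuple p); rewrite /= eqxx andbT.
by apply: sub_path pS => a b /and3P[].
Qed.

Lemma dist_le_hcard T x y : connected_hierarchy G T ->
  (dist G x y <= hcard T x y)%N.
Proof.
move=> conT; rewrite /hcard; case: eqVneq => [->|_]; first by rewrite distxx.
have inT z : z \in leaves T by rewrite (perm_mem (tree_leaves T)) mem_enum.
have [lT xl yl] := lca_clusters (inT x) (inT y).
by have := dist_lt_card (conT _ lT) xl yl; rewrite subn1; case: #|_|.
Qed.

(** * Sums over edges *)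

Lemma eq_edge_sum f g : (forall x y, adj G x y -> f x y = g x y) ->
  edge_sum G f = edge_sum G g.
Proof.
move=> fg; congr (_ * _); apply: eq_bigr => x _; apply: eq_bigr => y xy.
by rewrite fg.
Qed.

Lemma edge_sum_ge0 f : (forall x y, 0 <= f x y) -> 0 <= edge_sum G f.
Proof.
move=> f0; apply: mulr_ge0; first by rewrite invr_ge0.
apply: sumr_ge0 => x _; apply: sumr_ge0 => y xy.
by rewrite mulr_ge0 // ltW // wt_gt0.
Qed.

Lemma cost_D_hcard T :
  cost_D G T = edge_sum G (fun x y => (hcard T x y)%:R).
Proof.
apply: eq_edge_sum => x y; rewrite /hcard; case: eqVneq => // ->.
by rewrite adj_irr.
Qed.

Lemma OPT_card_le_cost_D T : connected_hierarchy G T ->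
  OPT_card G <= cost_D G T.
Proof.
move=> conT; apply: ge_inf.
  (* [ge_inf] asks for a set bounded below; 0 serves, as weights of edges are positive. *)
  exists 0 => _ [H [_ ->]]; exact: edge_sum_ge0.
exists T; split; last exact: cost_D_hcard.
by move=> x y; apply: dist_le_hcard.
Qed.

(** Both sides of the grouping are of this form: for [A] and [B] the whole of [V] it is twice
    [edge_sum G f], and for the two children of [S] and [f] constantly 1 it is [b_ G T S]. *)
Definition cross A B (f : V -> V -> R) : R :=
  \sum_(x in A) \sum_(y in B | adj G x y) wt G x y * f x y.

Lemma eq_cross A B f g : {in A & B, f =2 g} -> cross A B f = cross A B g.
Proof.
move=> fg; apply: eq_bigr => x xA; apply: eq_bigr => y /andP[yB _].
by rewrite fg.
Qed.

Lemma cross_swap A B f : cross A B f = cross B A (fun x y => f y x).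
Proof.
rewrite /cross; under eq_bigr do rewrite big_mkcondr.
rewrite exchange_big; apply: eq_bigr => x _; rewrite [RHS]big_mkcondr.
by apply: eq_bigr => y _; rewrite adj_sym wt_sym.
Qed.

Lemma crossUl A B C f : [disjoint A & B] ->
  cross (A :|: B) C f = cross A C f + cross B C f.
Proof. by move=> dAB; rewrite /cross sum_setU_disjoint. Qed.

Lemma crossUr A B C f : [disjoint A & B] ->
  cross C (A :|: B) f = cross C A f + cross C B f.
Proof. by move=> dAB; rewrite cross_swap crossUl // -!(cross_swap C). Qed.

Lemma cross_cst A B c : cross A B (fun _ _ => c) = cross A B (fun _ _ => 1) * c.
Proof.
rewrite /cross mulr_suml; apply: eq_bigr => x _; rewrite mulr_suml.
by apply: eq_bigr => y _; rewrite mulr1.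
Qed.

(* The factor 2: an edge is met once in each order on the left, but only from
   the first child to the second on the right. *)
Lemma cross_lca (f : {set V} -> R) t : uniq (leaves t) ->
  cross (cluster t) (cluster t) (fun x y => f (lca t x y)) =
  2 * \sum_(S in internal t)
        cross (children t S).1 (children t S).2 (fun _ _ => 1) * f S.
Proof.
elim: t => [v _|l IHl r IHr ut].
  rewrite big_set0 mulr0; apply: big1 => x; rewrite !inE => /eqP->.
  by apply: big1 => y /andP[]; rewrite !inE => /eqP->; rewrite adj_irr.
have [ul ur dlr] := uniq_leaves_node ut.
have [cT cl cr] := children_node ut.
rewrite big_internal_node // cT.
under eq_bigr => S Sl do rewrite cl //.
under [X in _ + (_ + X)]eq_bigr => S Sr do rewrite cr //.
rewrite !mulrDr -IHl // -IHr // -cross_cst.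
(* The pairs under the node form four blocks. The diagonal blocks match the induction hypotheses; on
   the other two the ancestor is the node itself. *)
rewrite [in cross _ _ (fun x y => f (lca _ x y))]cluster_node.
rewrite crossUl // !crossUr //.
set K := cluster (Node l r).
have -> : cross (cluster l) (cluster l) (fun x y => f (lca (Node l r) x y)) =
    cross (cluster l) (cluster l) (fun x y => f (lca l x y)).
  by apply: eq_cross => x y xl yl; have [->] := lca_node x y ut.
have -> : cross (cluster r) (cluster r) (fun x y => f (lca (Node l r) x y)) =
    cross (cluster r) (cluster r) (fun x y => f (lca r x y)).
  by apply: eq_cross => x y xr yr; have [_ ->] := lca_node x y ut.
have -> : cross (cluster l) (cluster r) (fun x y => f (lca (Node l r) x y)) =
    cross (cluster l) (cluster r) (fun _ _ => f K).
  by apply: eq_cross => x y xl yr; have [_ _ ->] := lca_node x y ut.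
have -> : cross (cluster r) (cluster l) (fun x y => f (lca (Node l r) x y)) =
    cross (cluster l) (cluster r) (fun _ _ => f K).
  (* Exchanging the endpoints identifies the second mixed block with the first, so the node
     contributes twice. *)
  rewrite cross_swap.
  by apply: eq_cross => x y xl yr; have [_ _ _ ->] := lca_node y x ut.
by rewrite mulr_natl mulr2n [RHS]addrACA [X in _ = X + _]addrC.
Qed.

Lemma edge_sum_lca (f : {set V} -> R) T :
  edge_sum G (fun x y => f (lca T x y)) = \sum_(S in internal T) b_ G T S * f S.
Proof.
have := cross_lca f (uniq_leaves T); rewrite cluster_hierarchy.
rewrite /cross /edge_sum.
under eq_bigl do rewrite inE.
under eq_bigr do under eq_bigl do rewrite inE /=.
(* The factor 2 cancels the one half in [edge_sum]. *)
move=> ->; rewrite mulKf ?pnatr_eq0 //.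
apply: eq_bigr => S _; congr (_ * _); apply: eq_bigr => x _.
by apply: eq_bigr => y _; rewrite mulr1.
Qed.

Lemma cost_D_div_Fdiam T :
  cost_D G T / Fdiam G T = \sum_(S in internal T) mu G T S * rho G S.
Proof.
rewrite /cost_D (edge_sum_lca (fun S => (#|S| - 1)%:R)) mulr_suml.
apply: eq_bigr => S ST; rewrite /mu /a_ /rho.
have d0 : (diam G S)%:R != 0 :> R.
  by rewrite pnatr_eq0 -lt0n diam_gt0 // (card_internal_gt1 (uniq_leaves T)).
(* Both sides carry the same factor [F^-1]; what remains is to cancel the nonzero diameter. *)
move: (Fdiam G T) => F.
rewrite (mulrC _ (b_ G T S)) mulf_div [in RHS]mulrAC -mulf_div.
by rewrite divff // mulr1 mulrAC.
Qed.

End Graph.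

Theorem lemma17 (R : realType) (V : finType) (G : wgraph R V)
    (hn : (2 <= #|V|)%N) :
  (forall T : hierarchy V, connected_hierarchy G T ->
     cost_D G T / Fdiam G T = \sum_(S in internal T) mu G T S * rho G S /\
     \sum_(S in internal T) mu G T S * rho G S =
       expectation (internal T) (mu G T) (rho G)) /\
  (forall Tstar : hierarchy V, connected_hierarchy G Tstar ->
     Fdiam G Tstar = OPT_free G ->
     OPT_card G / OPT_free G <=
       expectation (internal Tstar) (mu G Tstar) (rho G)).
Proof.
split=> [T _|T conT optT]; first by split; first exact: cost_D_div_Fdiam.
(* With [OPT_free G] replaced by [Fdiam G T], both sides are quotients by the same nonnegative
   number, and the numerators compare because [T] competes in [OPT_card]. *)
rewrite /expectation -cost_D_div_Fdiam -optT ler_wpM2r ?OPT_card_le_cost_D //.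
by rewrite invr_ge0 edge_sum_ge0.
Qed.
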